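(* Let $S$ be a linear operator on a Hilbert space $\mathcal{H}$. The following statements are equivalent: (i) $S$ is (densely defined and) skewadjoint; (ii) (a) $S\wedge(-S)$; (b) $\operatorname{ran}M_{S,-S}(\lambda)=\mathcal{H}\times\mathcal{H}$ for a certain (and also for all) $\lambda\in\mathbb{R}$, $\lambda\neq0$; (iii) (a) $S$ is closed and densely defined; (b) $S\wedge(-S)$; (c) $\operatorname{ran}(\lambda^2-S^2)=\mathcal{H}$ for a certain (and also for all) $\lambda\in\mathbb{R}$, $\lambda\neq0$. If $S^2$ is also closed, then condition (iii)(c) can be replaced by (c') $\overline{\operatorname{ran}(\lambda^2-S^2)}=\mathcal{H}$ for a certain (and also for all) $\lambda\in\mathbb{R}$, $\lambda\neq0$.
   Context: Hilbert spaces are real or complex. A linear operator $S$ on $\mathcal{H}$ is a linear map $S:\operatorname{dom}S\to\mathcal{H}$ defined on a linear subspace $\operatorname{dom}S\subseteq\mathcal{H}$; it is not assumed bounded, closed or densely defined unless stated. $\operatorname{dom}(S^2)=\{h\in\operatorname{dom}S:Sh\in\operatorname{dom}S\}$, and $\lambda^2-S^2$ is defined on $\operatorname{dom}(S^2)$. The adjoint $S^*$ of a densely defined $S$ has domain $\{k:\exists h'\ \forall h\in\operatorname{dom}S,\ \langle Sh,k\rangle=\langle h,h'\rangle\}$ and $S^*k:=h'$. $S$ is skewadjoint if it is densely defined and $S^*=-S$ (with equal domains). $S\wedge(-S)$ means $\langle Sh,k\rangle=\langle h,-Sk\rangle$ for all $h,k\in\operatorname{dom}S$. For a scalar $\lambda$,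 $M_{S,-S}(\lambda)=\begin{pmatrix}\lambda&S\\S&\lambda\end{pmatrix}$ is the operator on $\mathcal{H}\times\mathcal{H}$ with domain $\operatorname{dom}S\times\operatorname{dom}S$ given by $(h,k)\mapsto(\lambda h+Sk,\ Sh+\lambda k)$. ''For a certain (and also for all) $\lambda$'' means: the statement with ''for some $\lambda$'' and the statement with ''for all $\lambda$'' are both equivalent to the other listed statements. *)

(* Defs.v *)
From HB Require Import structures.
From mathcomp Require Import all_boot all_order all_algebra.
From mathcomp Require Import all_classical all_reals all_analysis.
From mathcomp Require Import complex.

Set Implicit Arguments.
Unset Strict Implicit.
Unset Printing Implicit Defensive.

Import Order.TTheory GRing.Theory Num.Theory.
Import numFieldNormedType.Exports.

Local Open Scope classical_set_scope.
Local Open Scope ring_scope.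

Variant scalars := RealScalars | ComplexScalars.

Definition scalarField (R : realType) (s : scalars) : numFieldType :=
  match s with RealScalars => R | ComplexScalars => R[i] end.

Definition scalarConj (R : realType) (s : scalars) :
    involutive_rmorphism (scalarField R s) :=
  match s with
  | RealScalars => (idfun : R -> R)
  | ComplexScalars => (Num.conj : R[i] -> R[i])
  end.

(* In MathComp-Analysis the norm of a module over K takes its values in K
   itself, so [inner_norm] says ||x||^2 = <x, x> in K. *)
Record hilbertSpace (R : realType) (s : scalars) := HilbertSpace {
  hilbert_sort :> completeNormedModType (scalarField R s);
  inner : {dot hilbert_sort for scalarConj R s};
  inner_norm : forall x : hilbert_sort, `|x| ^+ 2 = inner x x
}.

(* A linear map defined on the subspace [dom]. The values of [opfun] outside
   [dom] are irrelevant: no definition below depends on them. *)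
Record linop (K : numFieldType) (V W : lmodType K) := Linop {
  dom : set V;
  opfun :> V -> W;
  dom0 : dom 0;
  dom_linear : forall (a : K) (x y : V), dom x -> dom y -> dom (a *: x + y);
  op_linear : forall (a : K) (x y : V), dom x -> dom y ->
    opfun (a *: x + y) = a *: opfun x + opfun y
}.

Section Operators.
Variables (K : numFieldType) (V : lmodType K).

Definition ran (W : lmodType K) (T : linop V W) : set W := [set T x | x in dom T].

Definition op_graph (W : lmodType K) (T : linop V W) : set (V * W) :=
  [set p | dom T p.1 /\ p.2 = T p.1].

Section Opp.
Variable S : linop V V.

Fact opp_op_linear (a : K) (x y : V) : dom S x -> dom S y ->
  - S (a *: x + y) = a *: (- S x) + - S y.
Proof. by move=> Sx Sy; rewrite op_linear // opprD scalerN. Qed.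

Definition opp_op : linop V V :=
  Linop (dom0 S) (@dom_linear _ _ _ S) opp_op_linear.

End Opp.

Section Square.
Variable S : linop V V.

Let sdom : set V := [set h | dom S h /\ dom S (S h)].

Fact op_zero : S 0 = 0.
Proof.
have := op_linear (-1) (dom0 S) (dom0 S).
by rewrite scaler0 addr0 scaleN1r addNr.
Qed.

Fact square_dom0 : sdom 0.
Proof. by split; rewrite ?op_zero; apply: dom0. Qed.

Fact square_dom_linear (a : K) (x y : V) :
  sdom x -> sdom y -> sdom (a *: x + y).
Proof.
move=> [x1 x2] [y1 y2]; split; first exact: dom_linear.
by rewrite op_linear //; apply: dom_linear.
Qed.

Fact square_op_linear (a : K) (x y : V) : sdom x -> sdom y ->
  S (S (a *: x + y)) = a *: S (S x) + S (S y).
Proof. by move=> [x1 x2] [y1 y2]; rewrite !op_linear. Qed.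

Definition square_op : linop V V :=
  Linop square_dom0 square_dom_linear square_op_linear.

End Square.

Section ScalarSub.
Variables (c : K) (T : linop V V).

Fact scalar_sub_linear (a : K) (x y : V) : dom T x -> dom T y ->
  c *: (a *: x + y) - T (a *: x + y) = a *: (c *: x - T x) + (c *: y - T y).
Proof.
move=> Tx Ty; rewrite op_linear // scalerDr !scalerBr !scalerA (mulrC c a).
by rewrite opprD addrACA.
Qed.

Definition scalar_sub : linop V V :=
  Linop (dom0 T) (@dom_linear _ _ _ T) scalar_sub_linear.

End ScalarSub.

(* The operator matrix M_{S,-S}(l) = (l, S; S, l). *)
Section SkewMatrix.
Variables (S : linop V V) (l : K).

Let mdom : set (V * V) := dom S `*` dom S.
Let mfun (p : V * V) : V * V := (l *: p.1 + S p.2, S p.1 + l *: p.2).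

Fact skew_matrix_dom0 : mdom 0.
Proof. by split; apply: dom0. Qed.

Fact skew_matrix_dom_linear (a : K) (x y : V * V) :
  mdom x -> mdom y -> mdom (a *: x + y).
Proof. by move=> [x1 x2] [y1 y2]; split; apply: dom_linear. Qed.

Fact skew_matrix_op_linear (a : K) (x y : V * V) : mdom x -> mdom y ->
  mfun (a *: x + y) = a *: mfun x + mfun y.
Proof.
move=> [x1 x2] [y1 y2]; rewrite /mfun /=.
by congr (_, _); rewrite /= op_linear // !scalerDr !scalerA (mulrC l a) addrACA.
Qed.

Definition skew_matrix : linop (V * V)%type (V * V)%type :=
  Linop skew_matrix_dom0 skew_matrix_dom_linear skew_matrix_op_linear.

End SkewMatrix.

End Operators.

Section HilbertOperators.
Variables (R : realType) (s : scalars) (H : hilbertSpace R s).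
Implicit Types S T : linop H H.

Definition densely_defined S : Prop := dense (dom S).

Definition closed_op S : Prop := closed (op_graph S).

Definition wedge S T : Prop :=
  forall h k : H, dom S h -> dom T k -> inner H (S h) k = inner H h (T k).

Definition adjoint_spec S (k h' : H) : Prop :=
  forall h : H, dom S h -> inner H (S h) k = inner H h h'.

Definition adjoint_dom S : set H := [set k | exists h', adjoint_spec S k h'].

(* For densely defined S, [adjoint S k] is the only h' such that
   [adjoint_spec S k h']. *)
Definition adjoint S (k : H) : H := xget 0 [set h' | adjoint_spec S k h'].

Definition skewadjoint S : Prop :=
  [/\ densely_defined S,
      adjoint_dom S = dom (opp_op S) &
      forall k : H, dom (opp_op S) k -> adjoint S k = opp_op S k].

End HilbertOperators.

(* For K = R[i], [Num.real] is the real axis. *)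
Definition some_nonzero_real (K : numFieldType) (P : K -> Prop) : Prop :=
  exists l : K, [/\ l \is Num.real, l != 0 & P l].

Definition all_nonzero_real (K : numFieldType) (P : K -> Prop) : Prop :=
  forall l : K, l \is Num.real -> l != 0 -> P l.

(* Main.v *)
Require Import Defs.
From HB Require Import structures.
From mathcomp Require Import all_boot all_order all_algebra.
From mathcomp Require Import all_classical all_reals all_analysis.
From mathcomp Require Import complex ring.

Set Implicit Arguments.
Unset Strict Implicit.
Unset Printing Implicit Defensive.

Import Order.TTheory GRing.Theory Num.Theory.
Import numFieldNormedType.Exports.

Local Open Scope classical_set_scope.
Local Open Scope ring_scope.

(** Why skew-symmetry plus surjectivity is skewadjointness.

    Adding and subtracting the two components of M(l)(h, k) = (u, v) gives
    (l + S)(h + k) = u + v and (- l + S)(k - h) = u - v.  Hence M(l) is onto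
    exactly when both l + S and - l + S are onto
    ([skew_matrix_full_shift]).  The factorization
    l^2 - S^2 = (l + S)(l - S), valid on dom (S^2), shows in the same way that
    l^2 - S^2 is onto exactly when both are ([square_ran_full_shift]).  So the
    range conditions are all conditions on the two operators l + S, - l + S.

    Skew-symmetry cancels the cross terms in the norm, so that
    |(l + S) h|^2 = l^2 |h|^2 + |S h|^2 for real l ([norm_shift]).  For l <> 0
    the operator l + S is therefore bounded below, hence injective, and it has
    closed range as soon as S is closed ([closed_shift_ran]).

    If S is skewadjoint, it is closed because the adjoint is defined by closed
    conditions; a vector z orthogonal to the range of l + S satisfies
    S^* z = - l z, that is (- l + S) z = 0, and so vanishes.  A closed subspace
    with trivial orthogonal complement is everything ([closure_of_orth_eq0]),
    so l + S is onto, for every l ([skewadjoint_shift_full]).  Conversely, if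
    l + S and - l + S are onto for one l, then dom S has trivial orthogonal
    complement, so it is dense, and when <S h, k> = <h, k'> for all h, the
    element g with (- l + S) g = - (l k + k') must be k, which puts k in dom S
    ([shift_full_skewadjoint]).

    When only the density of the range of l^2 - S^2 is known, that range lies
    inside the closed ranges of l + S and - l + S, so both are onto
    ([dense_ran_shift_full]). *)

(** * Scalar identities *)

(** The identities below are stated over abstract rings, so that
    normalization does not have to look inside the choice between real and
    complex scalars.  This one is the value of |x - (u / n) y|^2, where
    u = <x, y>, v = <y, x>, m = |x|^2 and n = |y|^2. *)
Lemma projection_defect (K : fieldType) (u v m n : K) : n != 0 ->
  m - v / n * u - (u / n * v - u / n * (v / n * n)) = m - u * v / n.
Proof. by move=> n0; field. Qed.

Lemma polarized_norm_sub (K : comNzRingType) (a b c d : K) :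
  a - b - (c - d) = 2 * a + 2 * d - (a + b + (c + d)).
Proof. ring. Qed.

Lemma midpoint_defect (K : numFieldType) (d r : K) :
  2 * (d + (r / 2) ^+ 2) + 2 * (d + (r / 2) ^+ 2) - 2 ^+ 2 * d = r ^+ 2.
Proof. by field. Qed.

Lemma half_quotient (K : numFieldType) (e n : K) : n != 0 ->
  e / (2 * n) * n + e / (2 * n) * n = e.
Proof. by move=> n0; field. Qed.

(** * The scalar field *)

Lemma scalarConj_real (R : realType) (s : scalars) (a : scalarField R s) :
  a \is Num.real -> scalarConj R s a = a.
Proof. by case: s a => //= a /CrealP. Qed.

Lemma mul_scalarConj (R : realType) (s : scalars) (a : scalarField R s) :
  a * scalarConj R s a = `|a| ^+ 2.
Proof. by case: s a => /= a; rewrite ?normCK // -expr2 real_normK ?num_real. Qed.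

(** Norms take their values in the scalar field, which in the complex case is
    only partially ordered; sets of nonnegative scalars nevertheless have
    infima, because such scalars are real. *)
Lemma scalar_infimum (R : realType) (s : scalars) (A : set (scalarField R s)) :
  A !=set0 -> (forall a, A a -> 0 <= a) ->
  exists d, (forall a, A a -> d <= a) /\
            (forall e, 0 < e -> exists2 a, A a & a < d + e).
Proof.
have realcase (B : set R) : B !=set0 -> (forall a, B a -> 0 <= a) ->
    exists d, (forall a, B a -> d <= a) /\
              (forall e, 0 < e -> exists2 a, B a & a < d + e).
  move=> B0 Bge0; have Binf : has_inf B by split=> //; exists 0 => a /Bge0.
  exists (inf B); split=> [a Ba|e e0]; first by apply: ge_inf => //; case: Binf.
  by have [a Ba ltae] := inf_adherent e0 Binf; exists a.
case: s A => [|] A A0 Age0 /=; first exact: realcase.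
have geRe (z : R[i]) : 0 <= z -> z = (complex.Re z)%:C%C.
  by move=> /ger0_real /RRe_real.
have [||d [dle dinf]] := realcase [set r : R | A r%:C%C].
- by case: A0 => z Az; exists (complex.Re z) => /=; rewrite -geRe ?Age0.
- by move=> r /Age0; rewrite lecR.
exists d%:C%C; split=> [z Az|e e0].
  rewrite (geRe z) ?Age0 // lecR; apply: dle => /=.
  by rewrite -geRe ?Age0.
have [|r Ar ltr] := dinf (complex.Re e).
  by rewrite -ltcR -(geRe e (ltW e0)).
by exists r%:C%C => //; rewrite (geRe e (ltW e0)) -rmorphD ltcR.
Qed.

(** * Closures and completeness in normed spaces *)

Section NormedClosure.
Variables (K : numFieldType) (V : normedModType K).

Lemma closure_normP (A : set V) x :
  closure A x <-> forall e : K, 0 < e -> exists2 y, A y & `|x - y| < e.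
Proof.
split=> [clAx e e0|clAx B /nbhs_normP[e /= e0 sub]].
  have /clAx[y [Ay xye]] : nbhs x (ball x e) by exact: nbhsx_ballx.
  by exists y => //; move: xye; rewrite -ball_normE.
by have [y Ay xye] := clAx e e0; exists y; split=> //; apply: sub.
Qed.

Lemma closure_prod_normP (A : set (V * V)) (p : V * V) :
  closure A p <->
  forall e : K, 0 < e -> exists q, [/\ A q, `|p.1 - q.1| < e & `|p.2 - q.2| < e].
Proof.
split=> [clAp e e0|clAp B /nbhs_ballP[e /= e0 sub]].
  have /clAp[q [Aq]] : nbhs p (ball p e) by apply: nbhsx_ballx.
  by case; rewrite -!ball_normE => ? ?; exists q.
have [q [Aq q1 q2]] := clAp e e0; exists q; split=> //; apply: sub.
by split; rewrite -ball_normE.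
Qed.

Lemma dense_normP (A : set V) :
  dense A <-> closure A = [set: V].
Proof.
split=> [dA|clA O [x Ox] oO].
  apply/seteqP; split=> // x _ B; rewrite nbhsE => -[U [openU Ux] subUB].
  have [|y [Oy Ay]] := dA U _ openU; first by exists x.
  by exists y; split=> //; apply: subUB.
have /(_ O)[|y [Ay Oy]] : closure A x by rewrite clA.
  exact: open_nbhs_nbhs.
by exists y.
Qed.

End NormedClosure.

(** Cantor's intersection theorem in the form needed for approximate
    minimizers and approximate solutions: A e collects those of precision e.
    Indexing by scalars instead of integers avoids any appeal to an
    Archimedean property of K. *)
Lemma shrinking_family_limit (K : numFieldType) (V : completeNormedModType K)
    (A : K -> set V) :
  (forall e : K, 0 < e -> A e !=set0) ->
  (forall e e' : K, 0 < e -> e <= e' -> A e `<=` A e') ->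
  (forall r : K, 0 < r -> exists2 e : K, 0 < e &
     forall x y, A e x -> A e y -> `|x - y| < r) ->
  exists p, forall r e : K, 0 < r -> 0 < e -> exists2 x, A e x & `|p - x| < r.
Proof.
move=> A0 Amono Adiam.
pose F := filter_from [set e : K | 0 < e] A.
have FF : ProperFilter F.
  apply: filter_from_proper; last exact: A0.
  apply: filter_from_filter; first by exists 1; exact: ltr01.
  move=> e e' /= e0 e'0.
  have [lee|/ltW lee] := real_leP (gtr0_real e0) (gtr0_real e'0).
    by exists e => // x Ax; split=> //; apply: Amono Ax.
  by exists e' => // x Ax; split=> //; apply: Amono Ax.
have /cauchy_cvg : cauchy F.
  apply: cauchy_exP => r r0; have [e e0 eA] := Adiam r r0.
  have [x Ax] := A0 e e0; exists x, e => // y Ay.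
  by rewrite -ball_normE; apply: eA.
move=> /cvg_ex[p Fp].
exists p => r e r0 e0; have /Fp[e' /= e'0] : nbhs p (ball p r) by exact: nbhsx_ballx.
rewrite -ball_normE => subp.
have [lee|/ltW lee] := real_leP (gtr0_real e0) (gtr0_real e'0).
  by have [x Ax] := A0 e e0; exists x => //; apply: subp; apply: Amono Ax.
have [x Ax] := A0 e' e'0; exists x; first exact: Amono Ax.
exact: subp.
Qed.

(** * Inner products and orthogonal complements *)

Section InnerProduct.
Variables (R : realType) (s : scalars) (H : hilbertSpace R s).
Local Notation K := (scalarField R s).
Local Notation "''[' x , y ]" := (inner H x y) : ring_scope.
Implicit Types (x y z : H) (a : K).

Lemma innerDl z x y : '[x + y, z] = '[x, z] + '[y, z].
Proof. exact: linearDl. Qed.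
Lemma innerDr z x y : '[z, x + y] = '[z, x] + '[z, y].
Proof. exact: linearDr. Qed.
Lemma innerNr z x : '[z, - x] = - '[z, x].
Proof. exact: linearNr. Qed.
Lemma innerBl z x y : '[x - y, z] = '[x, z] - '[y, z].
Proof. exact: linearBl. Qed.
Lemma innerBr z x y : '[z, x - y] = '[z, x] - '[z, y].
Proof. exact: linearBr. Qed.
Lemma innerZl a x y : '[a *: x, y] = a * '[x, y].
Proof. exact: linearZl_LR. Qed.
Lemma innerZr a x y : '[x, a *: y] = scalarConj R s a * '[x, y].
Proof. exact: linearZr_LR. Qed.
Lemma inner_conj x y : '[y, x] = scalarConj R s '[x, y].
Proof. by rewrite hermC expr0 mul1r. Qed.

Lemma innerZr_real a x y : a \is Num.real -> '[x, a *: y] = a * '[x, y].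
Proof. by move=> ra; rewrite innerZr scalarConj_real. Qed.

Lemma inner_eq0C x y : '[x, y] = 0 -> '[y, x] = 0.
Proof. by move=> xy0; rewrite inner_conj xy0 rmorph0. Qed.

Lemma inner_self_eq0 x : '[x, x] = 0 -> x = 0.
Proof. by rewrite -inner_norm => /eqP; rewrite expf_eq0 normr_eq0 => /eqP. Qed.

(** Removing from x its component along y lowers the squared norm by the
    squared length of that component; nonnegativity of the result is the
    Cauchy-Schwarz inequality, and minimality of |x| along the line x + K y
    forces <x, y> = 0. *)
Lemma norm_sub_proj x y : y != 0 ->
  `|x - ('[x, y] / '[y, y]) *: y| ^+ 2 = `|x| ^+ 2 - `|'[x, y]| ^+ 2 / `|y| ^+ 2.
Proof.
move=> y0; have ny0 : `|y| ^+ 2 != 0 by rewrite expf_neq0 // normr_eq0.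
set t := '[x, y] / _.
have ct : scalarConj R s t = '[y, x] / `|y| ^+ 2.
  by rewrite /t rmorphM /= -inner_conj fmorphV -inner_norm /= scalarConj_real //.
rewrite inner_norm !(innerBl, innerBr, innerZl, innerZr) -!inner_norm ct.
rewrite -mul_scalarConj -inner_conj /t -inner_norm.
exact: projection_defect.
Qed.

Lemma cauchy_schwarz x y : `|'[x, y]| <= `|x| * `|y|.
Proof.
have [->|y0] := eqVneq y 0; first by rewrite linear0r !normr0 mulr0.
have ny0 : 0 < `|y| ^+ 2 by rewrite exprn_gt0 // normr_gt0.
rewrite -ler_sqr ?nnegrE ?mulr_ge0 // exprMn -ler_pdivrMr // -subr_ge0.
by rewrite -norm_sub_proj // exprn_ge0.
Qed.

Lemma parallelogram x y :
  `|x - y| ^+ 2 = 2 * `|x| ^+ 2 + 2 * `|y| ^+ 2 - `|x + y| ^+ 2.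
Proof.
rewrite !inner_norm !(innerBl, innerBr, innerDl, innerDr).
exact: polarized_norm_sub.
Qed.

(** The projection theorem, specialized to subspaces with trivial orthogonal
    complement.  The points of M that nearly minimize the distance to x form a
    Cauchy family by the parallelogram law; their limit p makes x - p
    orthogonal to M, since otherwise moving along M would bring one closer to
    x.  Hence x = p is a limit of points of M. *)
Lemma closure_of_orth_eq0 (M : set H) :
  M 0 -> (forall a x y, M x -> M y -> M (a *: x + y)) ->
  (forall z, (forall m, M m -> '[z, m] = 0) -> z = 0) ->
  closure M = setT.
Proof.
move=> M0 Mlin orth0; apply/seteqP; split=> // x _.
have [||D [Dle Dinf]] := @scalar_infimum R s [set `|x - m| ^+ 2 | m in M].
- by exists (`|x - 0| ^+ 2), 0.
- by move=> _ [m _ <-]; rewrite exprn_ge0.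
have {}Dle m : M m -> D <= `|x - m| ^+ 2 by move=> Mm; apply: Dle; exists m.
(* Precision e^2 in the squared distance makes both the diameter of A e and
   the inner products of x - m with unit vectors of M of order e. *)
pose A (e : K) := [set m | M m /\ `|x - m| ^+ 2 < D + e ^+ 2].
have [|||p pA] := @shrinking_family_limit K H A.
- move=> e e0; have [|_ [m Mm <-] lt] := Dinf (e ^+ 2); first exact: exprn_gt0.
  by exists m.
- move=> e e' e0 lee m [Mm ltm]; split=> //; apply: lt_le_trans ltm _.
  by rewrite lerD2l ler_pXn2r ?nnegrE // ltW // (lt_le_trans e0).
- move=> r r0; exists (r / 2); first by rewrite divr_gt0.
  move=> m m' [Mm ltm] [Mm' ltm'].
  (* The midpoint of m and m' lies in M, so it is at distance at least D. *)
  have Mmid : M ((1 / 2) *: m + ((1 / 2) *: m' + 0)).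
    exact: (Mlin _ _ _ Mm (Mlin _ _ _ Mm' M0)).
  rewrite -ltr_sqr ?nnegrE ?(ltW r0) //.
  have -> : m - m' = (x - m') - (x - m) by rewrite opprB [RHS]addrC addrA subrK.
  rewrite parallelogram.
  have -> : (x - m') + (x - m) =
      (2 : K) *: (x - ((1 / 2) *: m + ((1 / 2) *: m' + 0))).
    rewrite addr0 -scalerDr scalerBr scalerA mul1r mulfV ?pnatr_eq0 // scale1r.
    by rewrite scaler_nat mulr2n addrACA -opprD (addrC m').
  rewrite normrZ exprMn normr_nat.
  have := Dle _ Mmid; set c := `|x - (_ + _)| ^+ 2 => Dc.
  apply: (@lt_le_trans _ _ (2 * (D + (r / 2) ^+ 2) + 2 * (D + (r / 2) ^+ 2)
     - 2 ^+ 2 * D)).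
    apply: ltr_leD; first by apply: ltrD; rewrite ltr_pM2l.
    by rewrite lerN2 ler_pM2l.
  by rewrite midpoint_defect.
have px : x - p = 0.
  apply: orth0 => m Mm; have [->|m0] := eqVneq m 0; first exact: linear0r.
  apply/eqP; rewrite -normr_le0; apply/ler_addgt0Pr => e e0; rewrite add0r.
  have nm0 : 0 < `|m| by rewrite normr_gt0.
  have [d d0 ->] : exists2 d : K, 0 < d & e = d * `|m| + d * `|m|.
    exists (e / (2 * `|m|)); first by rewrite divr_gt0 // mulr_gt0.
    by rewrite half_quotient ?lt0r_neq0.
  have [q [Mq ltq] ltpq] := pA d d d0 d0.
  have -> : x - p = (x - q) - (p - q) by rewrite opprB addrA subrK.
  rewrite innerBl; apply: le_trans (ler_normB _ _) _.
  apply: lerD; last first.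
    by apply: le_trans (cauchy_schwarz _ _) _; rewrite ler_pM2r // ltW.
  (* Compare D with the distance from x to the best point on q + K m. *)
  have := Dle _ (Mlin ('[x - q, m] / '[m, m]) _ _ Mm Mq).
  rewrite opprD addrCA addrC norm_sub_proj // => Dlt.
  rewrite -ler_sqr ?nnegrE ?mulr_ge0 ?(ltW d0) //.
  rewrite exprMn -ler_pdivrMr ?exprn_gt0 // ltW //.
  rewrite -(ltrD2l D); apply: le_lt_trans ltq.
  by rewrite -lerBrDr.
apply/closure_normP => e e0; have [q [Mq _] ltq] := pA e e e0 e0.
by exists q => //; rewrite (subr0_eq px).
Qed.

End InnerProduct.

(** * Range conditions in terms of l + S *)

Section LinearOperators.
Variables (K : numFieldType) (V : lmodType K) (S : linop V V).
Implicit Types (l : K) (x y h : V).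

Lemma domZ l x : dom S x -> dom S (l *: x).
Proof. by move=> Sx; rewrite -[_ *: _]addr0; apply: dom_linear => //; exact: dom0. Qed.

Lemma opZ l x : dom S x -> S (l *: x) = l *: S x.
Proof.
by move=> Sx; rewrite -[_ *: x]addr0 op_linear ?op_zero ?addr0 //; exact: dom0.
Qed.

Lemma domD x y : dom S x -> dom S y -> dom S (x + y).
Proof. by move=> Sx Sy; rewrite -[x]scale1r; apply: dom_linear. Qed.

Lemma opD x y : dom S x -> dom S y -> S (x + y) = S x + S y.
Proof. by move=> Sx Sy; rewrite -[x]scale1r op_linear ?scale1r. Qed.

Lemma domN x : dom S x -> dom S (- x).
Proof. by rewrite -scaleN1r; apply: domZ. Qed.

Lemma opN x : dom S x -> S (- x) = - S x.
Proof. by move=> Sx; rewrite -[in LHS]scaleN1r opZ // scaleN1r. Qed.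

Lemma domB x y : dom S x -> dom S y -> dom S (x - y).
Proof. by move=> Sx Sy; apply: domD => //; apply: domN. Qed.

Lemma opB x y : dom S x -> dom S y -> S (x - y) = S x - S y.
Proof. by move=> Sx Sy; rewrite opD ?opN //; apply: domN. Qed.

(** The range of l + S.  The operator l - S is covered by the parameter - l,
    because its range is that of - l + S. *)
Definition shift_ran l : set V := [set l *: h + S h | h in dom S].

Lemma shift_ran0 l : shift_ran l 0.
Proof. by exists 0; [exact: dom0 | rewrite op_zero scaler0 addr0]. Qed.

Lemma shift_ran_linear l a x y :
  shift_ran l x -> shift_ran l y -> shift_ran l (a *: x + y).
Proof.
move=> [h Sh <-] [k Sk <-]; exists (a *: h + k); first exact: dom_linear.
by rewrite op_linear // !scalerDr addrACA !scalerA mulrC.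
Qed.

(** On dom (S^2), l^2 - S^2 = (l + S)(l - S) = (- l + S)(- (l + S)). *)
Lemma square_ran_sub_shift l :
  ran (scalar_sub (l ^+ 2) (square_op S)) `<=` shift_ran l `&` shift_ran (- l).
Proof.
move=> _ [h [Sh SSh] <-] /=; split.
  exists (l *: h - S h); first by apply: domB => //; exact: domZ.
  rewrite opB ?opZ //; last exact: domZ.
  by rewrite scalerBr scalerA addrA subrK.
exists (- (l *: h + S h)); first by apply: domN; apply: domD => //; exact: domZ.
rewrite opN ?opD ?opZ //; [|exact: domZ|by apply: domD => //; exact: domZ].
rewrite scaleNr scalerN opprK opprD scalerDr scalerA.
by rewrite -/(_ - _) addrA addrK.
Qed.

(** To solve (l^2 - S^2) f = x, solve (l + S) h = x and then (- l + S) k = h: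
    then S k = l k + h is in dom S, and f = - k is the solution. *)
Lemma square_ran_full_shift l :
  ran (scalar_sub (l ^+ 2) (square_op S)) = setT <->
  shift_ran l = setT /\ shift_ran (- l) = setT.
Proof.
split=> [full|[fullp fulln]].
  by split; apply/seteqP; split=> // x _;
    have /square_ran_sub_shift[] : ran (scalar_sub (l ^+ 2) (square_op S)) x
      by rewrite full.
apply/seteqP; split=> // x _.
have [h Sh eqx] : shift_ran l x by rewrite fullp.
have [k Sk eqh] : shift_ran (- l) h by rewrite fulln.
have eqSk : S k = l *: k + h by rewrite -eqh scaleNr addrA subrr add0r.
have SSk : dom S (S k) by rewrite eqSk; apply: dom_linear.
exists (- k); first by split; rewrite ?opN //; apply: domN.
rewrite /= !opN // scalerN opprK {1}eqSk op_linear // {1}eqSk.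
by rewrite -eqx scalerDr scalerA -!addrA addKr.
Qed.

Lemma half_sum_half_diff x y :
  2^-1 *: (x + y) + 2^-1 *: (x - y) = x.
Proof.
rewrite -scalerDr addrACA subrr addr0 -mulr2n -[x *+ 2]scaler_nat scalerA.
by rewrite mulVf ?pnatr_eq0 // scale1r.
Qed.

(** The change of variables p = h + k, q = k - h turns M(l)(h, k) = (u, v) into
    the decoupled system (l + S) p = u + v, (- l + S) q = u - v. *)
Lemma skew_matrix_full_shift l :
  ran (skew_matrix S l) = setT <->
  shift_ran l = setT /\ shift_ran (- l) = setT.
Proof.
split=> [full|[fullp fulln]].
  split; apply/seteqP; split=> // x _;
    have [[h k] [/= Sh Sk] [eqx eq0]] : ran (skew_matrix S l) (x, 0)
      by rewrite full.
  - exists (h + k); first exact: domD.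
    by rewrite opD // (addrC (S h)) scalerDr addrACA eqx (addrC _ (S h)) eq0 addr0.
  - exists (k - h); first exact: domB.
    rewrite opB // scaleNr -scalerN opprB scalerBr addrACA eqx -opprD.
    by rewrite (addrC _ (S h)) eq0 subr0.
apply/seteqP; split=> // -[u v] _.
have [p Sp eqp] : shift_ran l (2^-1 *: (u + v)) by rewrite fullp.
have [q Sq eqq] : shift_ran (- l) (2^-1 *: (u - v)) by rewrite fulln.
(* With halved right-hand sides, p = (h + k) / 2 and q = (k - h) / 2. *)
exists (p - q, p + q); first by split; [exact: domB | exact: domD].
congr (_, _); rewrite /= ?opB ?opD // scalerDr.
  by rewrite scalerN -scaleNr addrACA eqp eqq half_sum_half_diff.
rewrite addrC addrACA -[l *: q]opprK -scaleNr -opprD eqp eqq.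
by rewrite -scalerN opprB (addrC u) half_sum_half_diff.
Qed.

End LinearOperators.

(** * Skew-symmetric and skewadjoint operators *)

Section SkewOperators.
Variables (R : realType) (s : scalars) (H : hilbertSpace R s) (S : linop H H).
Local Notation K := (scalarField R s).
Local Notation "''[' x , y ]" := (inner H x y) : ring_scope.
Local Notation skew := (wedge S (opp_op S)).
Implicit Types (x y h k : H) (l : K).

Lemma skew_inner h k : skew -> dom S h -> dom S k -> '[S h, k] = - '[h, S k].
Proof. by move=> sk Sh Sk; rewrite sk // innerNr. Qed.

(** Skew-symmetry makes the cross terms l <h, S h> and l <S h, h> cancel; this
    needs l to be real. *)
Lemma norm_shift l h : skew -> l \is Num.real -> dom S h ->
  `|l *: h + S h| ^+ 2 = (`|l| * `|h|) ^+ 2 + `|S h| ^+ 2.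
Proof.
move=> sk lr Sh; rewrite -normrZ !inner_norm !(innerDl, innerDr).
rewrite (innerZl l h (S h)) (innerZr_real (S h) h lr) (skew_inner sk Sh Sh).
by rewrite mulrN addrA addrK.
Qed.

Lemma ge_norm_shift l h : skew -> l \is Num.real -> dom S h ->
  `|l| * `|h| <= `|l *: h + S h|.
Proof.
move=> sk lr Sh; rewrite -ler_sqr ?nnegrE ?mulr_ge0 // norm_shift //.
by rewrite lerDl exprn_ge0.
Qed.

Lemma shift_eq0 l h : skew -> l \is Num.real -> l != 0 -> dom S h ->
  l *: h + S h = 0 -> h = 0.
Proof.
move=> sk lr l0 Sh eq0; apply/eqP; have := ge_norm_shift sk lr Sh.
by rewrite eq0 normr0 pmulr_rle0 ?normr_gt0 // normr_le0.
Qed.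

(** If (l + S) h_n converges to y, the lower bound on l + S makes h_n Cauchy,
    with limit p say; then S h_n converges to y - l p, and closedness of S gives
    (l + S) p = y. *)
Lemma closed_shift_ran l : closed_op S -> skew -> l \is Num.real -> l != 0 ->
  closed (shift_ran S l).
Proof.
move=> clS sk lr l0 y cly.
have nl0 : 0 < `|l| by rewrite normr_gt0.
pose A (e : K) := [set h | dom S h /\ `|y - (l *: h + S h)| < e].
have [|||p pA] := @shrinking_family_limit K H A.
- move=> e e0; have /closure_normP /(_ e e0)[_ [h Sh <-] lte] := cly.
  by exists h.
- by move=> e e' _ lee h [Sh lte]; split=> //; apply: lt_le_trans lte lee.
- move=> r r0; exists (`|l| * r / 2); first by rewrite divr_gt0 // mulr_gt0.
  move=> h k [Sh lth] [Sk ltk].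
  rewrite -(ltr_pM2l nl0); apply: le_lt_trans (ge_norm_shift sk lr (domB Sh Sk)) _.
  rewrite opB // scalerBr addrACA -opprD.
  rewrite -[X in `|X|](subrKA y) [X in _ < X]splitr.
  apply: le_lt_trans (ler_normD _ _) _; apply: ltrD => //.
  by rewrite distrC.
have graph_p : op_graph S (p, y - l *: p).
  apply: clS; apply/closure_prod_normP => e e0.
  (* With precision r = e / (1 + |l|), the second coordinate is off by at most
     r + |l| r = e. *)
  have l1 : 0 < 1 + `|l| by rewrite addr_gt0.
  have r0 : 0 < e / (1 + `|l|) by rewrite divr_gt0.
  have [h [Sh lth] ltp] := pA _ _ r0 r0.
  exists (h, S h); split=> //=.
    by apply: lt_le_trans ltp _; rewrite ler_pdivrMr // ler_peMr ?lerDl // ltW.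
  have -> : y - l *: p - S h = (y - (l *: h + S h)) - l *: (p - h).
    by rewrite scalerBr opprB opprD [RHS]addrACA -!addrA addNKr (addrC (- S h)).
  apply: le_lt_trans (ler_normB _ _) _; rewrite normrZ.
  rewrite -[X in _ < X](divfK (lt0r_neq0 l1)) mulrDr mulr1 (mulrC _ `|l|).
  by apply: ltrD => //; rewrite ltr_pM2l.
case: graph_p => /= Sp eqy; exists p => //.
by rewrite -eqy addrC subrK.
Qed.

Lemma skewadjoint_wedge : skewadjoint S -> skew.
Proof.
move=> [_ domE adjE] h k Sh Sk; rewrite -adjE //.
have : adjoint_dom S k by rewrite domE.
by move=> /(@xgetPex _ 0 [set h' | adjoint_spec S k h']); apply.
Qed.

Lemma dense_orth (A : set H) z : dense A -> (forall a, A a -> '[a, z] = 0) ->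
  z = 0.
Proof.
move=> /dense_normP clA Az0; apply/inner_self_eq0/eqP; rewrite -normr_le0.
apply/ler_addgt0Pr => e e0; rewrite add0r.
have n0 : 0 < 1 + `|z| by rewrite ltr_pwDl.
have /closure_normP/(_ (e / (1 + `|z|)))[|a Aa lta] : closure A z by rewrite clA.
  by rewrite divr_gt0.
have -> : '[z, z] = '[z - a, z] by rewrite innerBl (Az0 a Aa) subr0.
apply: le_trans (cauchy_schwarz _ _) _.
rewrite -[X in _ <= X](divfK (lt0r_neq0 n0)).
by apply: ler_pM => //; [exact: ltW | rewrite lerDr].
Qed.

(** For skewadjoint S, the defining relation of the adjoint describes exactly
    the graph of - S.  Density of dom S gives uniqueness of k'. *)
Lemma skewadjoint_adjoint_spec k k' : skewadjoint S ->
  adjoint_spec S k k' <-> dom S k /\ k' = - S k.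
Proof.
move=> skS; split=> [kk'|[Sk ->] h Sh]; last first.
  by rewrite skew_inner // ?innerNr //; exact: skewadjoint_wedge.
have [dS domE adjE] := skS.
have Sk : dom S k by rewrite -[dom S]/(dom (opp_op S)) -domE; exists k'.
split=> //; apply/eqP; rewrite -subr_eq0; apply/eqP.
apply: (dense_orth dS) => h Sh; rewrite innerBr -kk' //.
by rewrite (skewadjoint_wedge skS) // subrr.
Qed.

(** The relation <S h, x> = <h, - y> is preserved by limits of (x, y), and for
    skewadjoint S it characterizes the graph. *)
Lemma skewadjoint_closed : skewadjoint S -> closed_op S.
Proof.
move=> skS [x y] cl.
suff /(skewadjoint_adjoint_spec _ _ skS)[Sx /oppr_inj ->] : adjoint_spec S x (- y) by [].
move=> h Sh; apply/eqP; rewrite -subr_eq0 innerNr opprK -normr_le0.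
apply/ler_addgt0Pr => e e0; rewrite add0r.
have n0 : 0 < `|S h| + `|h| + 1 by rewrite ltr_wpDl // addr_ge0.
have r0 : 0 < e / (`|S h| + `|h| + 1) by rewrite divr_gt0.
have /closure_prod_normP/(_ _ r0)[[a b] [/= [/= Sa ->] lta ltb]] := cl.
have -> : '[S h, x] + '[h, y] = '[S h, x - a] + '[h, y - S a].
  rewrite !innerBr addrACA -opprD (skew_inner (skewadjoint_wedge skS) Sh Sa).
  by rewrite addNr subr0.
apply: le_trans (ler_normD _ _) _.
rewrite -[X in _ <= X](divfK (lt0r_neq0 n0)) !mulrDr mulr1 -[X in X <= _]addr0.
apply: lerD; last exact: ltW.
by apply: lerD; (apply: le_trans (cauchy_schwarz _ _) _);
  rewrite mulrC ler_wpM2r // ltW.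
Qed.

(** A vector orthogonal to the range of l + S is in the domain of the adjoint
    and is annihilated by - l + S, which is injective. *)
Lemma skewadjoint_shift_full l : skewadjoint S -> l \is Num.real -> l != 0 ->
  shift_ran S l = setT.
Proof.
move=> skS lr l0; have sk := skewadjoint_wedge skS.
have cl : closed (shift_ran S l).
  by apply: closed_shift_ran => //; apply: skewadjoint_closed.
rewrite ((closure_id (shift_ran S l)).1 cl); apply: closure_of_orth_eq0.
- exact: shift_ran0.
- by move=> a x y; apply: shift_ran_linear.
move=> z orthz.
have : adjoint_spec S z (- (l *: z)).
  move=> h Sh; apply/eqP; rewrite innerNr innerZr_real // -subr_eq0 opprK addrC.
  by rewrite -innerZl -innerDl; apply/eqP/inner_eq0C/orthz; exists h.
move=> /(skewadjoint_adjoint_spec _ _ skS)[Sz /oppr_inj eqz].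
apply: (@shift_eq0 (- l)); rewrite ?rpredN ?oppr_eq0 //.
by rewrite scaleNr eqz addNr.
Qed.

(** If z = (l + S) h is orthogonal to dom S, it is orthogonal to h.  Then
    <z, h> + <h, z> = 2 l <h, h> vanishes, the terms in S cancelling. *)
Lemma shift_full_dense l : skew -> l \is Num.real -> l != 0 ->
  shift_ran S l = setT -> dense (dom S).
Proof.
move=> sk lr l0 full; apply/dense_normP/closure_of_orth_eq0.
- exact: dom0.
- by move=> a x y; apply: dom_linear.
move=> z orthz; have [h Sh eqz] : shift_ran S l z by rewrite full.
have hz := orthz h Sh; have zh := inner_eq0C hz.
have minus0 : l * '[h, h] - '[h, S h] = 0.
  by rewrite -(skew_inner sk Sh Sh) -innerZl -innerDl eqz.
have plus0 : l * '[h, h] + '[h, S h] = 0.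
  by rewrite -(innerZr_real h h lr) -innerDr eqz.
have : l * '[h, h] + l * '[h, h] = 0.
  transitivity ((l * '[h, h] - '[h, S h]) + (l * '[h, h] + '[h, S h])).
    by rewrite addrACA addNr addr0.
  by rewrite minus0 plus0 addr0.
rewrite -mulrDr -mulr2n => /eqP; rewrite mulf_eq0 (negPf l0) mulrn_eq0 /=.
move=> /eqP/inner_self_eq0 h0.
by rewrite -eqz h0 op_zero scaler0 addr0.
Qed.

(** Surjectivity of - l + S produces the candidate g for k in dom S, and
    surjectivity of l + S shows that k - g is orthogonal to everything. *)
Lemma shift_full_skewadjoint l : skew -> l \is Num.real -> l != 0 ->
  shift_ran S l = setT -> shift_ran S (- l) = setT -> skewadjoint S.
Proof.
move=> sk lr l0 fullp fulln; have dS := shift_full_dense sk lr l0 fullp.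
have specE k k' : adjoint_spec S k k' -> dom S k /\ k' = - S k.
  move=> kk'.
  have [g Sg eqg] : shift_ran S (- l) (- (l *: k + k')) by rewrite fulln.
  have kg : k - g = 0.
    have [f Sf eqf] : shift_ran S l (k - g) by rewrite fullp.
    apply: inner_self_eq0; rewrite -{1}eqf.
    rewrite innerBr !(innerDl, innerZl) kk' // skew_inner //.
    rewrite -!innerZr_real // -innerNr -!innerDr -innerBr.
    rewrite -[l *: k + k']opprK -eqg scaleNr opprD opprK.
    by rewrite subrr linear0r.
  move: kg Sg eqg => /subr0_eq <- Sk; rewrite scaleNr opprD => /addrI ->.
  by rewrite opprK.
split=> //.
  apply/seteqP; split=> k; first by move=> [k' /specE[]].
  by move=> Sk; exists (- S k) => h Sh; apply: sk.
move=> k Sk; rewrite /adjoint; case: xgetP => [k' _ /specE[]//|none].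
by case: (none (- S k)) => h Sh; apply: sk.
Qed.

(** The dense range of l^2 - S^2 lies in the ranges of l + S and - l + S, which
    are closed. *)
Lemma dense_ran_shift_full l : closed_op S -> skew ->
  l \is Num.real -> l != 0 ->
  closure (ran (scalar_sub (l ^+ 2) (square_op S))) = setT ->
  shift_ran S l = setT /\ shift_ran S (- l) = setT.
Proof.
move=> clS sk lr l0 dran.
have sub := @square_ran_sub_shift K H S l.
split; apply/seteqP; split=> // x _.
  apply: (closed_shift_ran clS sk lr l0).
  have : closure (ran (scalar_sub (l ^+ 2) (square_op S))) x by rewrite dran.
  by apply: closureS => z /sub[].
apply: (@closed_shift_ran (- l) clS sk); rewrite ?rpredN ?oppr_eq0 //.
have : closure (ran (scalar_sub (l ^+ 2) (square_op S))) x by rewrite dran.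
by apply: closureS => z /sub[].
Qed.

End SkewOperators.

Theorem corollary3p5 (R : realType) (s : scalars) (H : hilbertSpace R s)
    (S : linop H H) :
  let ran_matrix_full (l : scalarField R s) :=
    ran (skew_matrix S l) = [set: H * H] in
  let ran_full (l : scalarField R s) :=
    ran (scalar_sub (l ^+ 2) (square_op S)) = [set: H] in
  let ran_dense (l : scalarField R s) :=
    closure (ran (scalar_sub (l ^+ 2) (square_op S))) = [set: H] in
  [<-> skewadjoint S;
       wedge S (opp_op S) /\ some_nonzero_real ran_matrix_full;
       wedge S (opp_op S) /\ all_nonzero_real ran_matrix_full;
       [/\ closed_op S /\ densely_defined S, wedge S (opp_op S) &
           some_nonzero_real ran_full];
       [/\ closed_op S /\ densely_defined S, wedge S (opp_op S) &
           all_nonzero_real ran_full]]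
  /\
  (closed_op (square_op S) ->
   [<-> skewadjoint S;
        wedge S (opp_op S) /\ some_nonzero_real ran_matrix_full;
        wedge S (opp_op S) /\ all_nonzero_real ran_matrix_full;
        [/\ closed_op S /\ densely_defined S, wedge S (opp_op S) &
            some_nonzero_real ran_dense];
        [/\ closed_op S /\ densely_defined S, wedge S (opp_op S) &
            all_nonzero_real ran_dense]]).
Proof.
move=> ran_matrix_full ran_full ran_dense.
have nz_real1 (P : scalarField R s -> Prop) :
    all_nonzero_real P -> some_nonzero_real P.
  by move=> allP; exists 1; split; rewrite ?oner_eq0 ?realE ?ler01 //; apply: allP;
    rewrite ?oner_eq0 ?realE ?ler01.
have skew_all_shift : skewadjoint S -> all_nonzero_real (fun l =>
    shift_ran S l = setT /\ shift_ran S (- l) = setT).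
  move=> skS l lr l0; split; apply: skewadjoint_shift_full => //.
    by rewrite rpredN.
  by rewrite oppr_eq0.
have skew_matrix_all : skewadjoint S ->
    wedge S (opp_op S) /\ all_nonzero_real ran_matrix_full.
  move=> skS; split; first exact: skewadjoint_wedge.
  by move=> l lr l0; apply/skew_matrix_full_shift/skew_all_shift.
have matrix_some_skew :
    wedge S (opp_op S) /\ some_nonzero_real ran_matrix_full -> skewadjoint S.
  move=> [sk [l [lr l0 /skew_matrix_full_shift[fullp fulln]]]].
  exact: shift_full_skewadjoint fulln.
have skew_ran_all : skewadjoint S ->
    [/\ closed_op S /\ densely_defined S, wedge S (opp_op S) &
        all_nonzero_real ran_full].
  move=> skS; split; [|exact: skewadjoint_wedge|].
    by split; [exact: skewadjoint_closed|case: skS].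
  by move=> l lr l0; apply/square_ran_full_shift/skew_all_shift.
have full_dense l : ran_full l -> ran_dense l.
  by rewrite /ran_dense => ->; rewrite closureT.
have dense_some_skew :
    [/\ closed_op S /\ densely_defined S, wedge S (opp_op S) &
        some_nonzero_real ran_dense] -> skewadjoint S.
  move=> [[clS _] sk [l [lr l0 dran]]].
  have [fullp fulln] := dense_ran_shift_full clS sk lr l0 dran.
  exact: shift_full_skewadjoint fulln.
have full_some_skew :
    [/\ closed_op S /\ densely_defined S, wedge S (opp_op S) &
        some_nonzero_real ran_full] -> skewadjoint S.
  move=> [cd sk [l [lr l0 /full_dense dran]]].
  by apply: dense_some_skew; split=> //; exists l.
split=> [|_]; tfae.
- by move=> /skew_matrix_all[sk /nz_real1].
- by move=> /matrix_some_skew/skew_matrix_all.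
- move=> [sk /nz_real1 full].
  by have [cd _ /nz_real1] := skew_ran_all (matrix_some_skew (conj sk full)).
- by move=> /full_some_skew/skew_ran_all.
- by move=> [cd sk /nz_real1 full]; apply: full_some_skew.
- by move=> /skew_matrix_all[sk /nz_real1].
- by move=> /matrix_some_skew/skew_matrix_all.
- move=> [sk /nz_real1 full].
  have [cd _ all] := skew_ran_all (matrix_some_skew (conj sk full)).
  by split=> //; apply: nz_real1 => l lr l0; apply/full_dense/all.
- move=> /dense_some_skew/skew_ran_all[cd sk all].
  by split=> // l lr l0; apply/full_dense/all.
- by move=> [cd sk /nz_real1 full]; apply: dense_some_skew.
Qed.
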